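(* Let $V$ be a vector space over a field $K$, with $\dim V \geq 2$ (infinite dimension allowed). Then: a) If $\dim V$ and $\# K$ are not both infinite, then $\operatorname{LC}(V) = \# K + 1$. b) If $\dim V$ and $\# K$ are both infinite, then $\operatorname{LC}(V) = \aleph_0$. c) In all cases, $\operatorname{ILC}(V) = \# K + 1$.
   Context: $\# S$ denotes the cardinality of a set $S$, and $\dim V$ denotes the cardinality of any $K$-basis of $V$, a possibly infinite cardinal. All arithmetic and comparisons are of cardinal numbers. A linear covering of a $K$-vector space $V$ is a collection $\{W_i\}_{i \in I}$ of proper $K$-linear subspaces of $V$ such that $V = \bigcup_{i \in I} W_i$. Linear coverings exist if and only if $\dim V \geq 2$. A linear covering is irredundant if for every proper subset $J \subsetneq I$ one has $\bigcup_{i \in J} W_i \neq V$. For $\dim V \geq 2$, the linear covering number $\operatorname{LC}(V)$ is the least cardinality $\# I$ of a linear covering $\{W_i\}_{i \in I}$ of $V$, and the irredundant linear covering number $\operatorname{ILC}(V)$ is the least cardinality of an irredundant linear covering of $V$. *)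

(* Defs.v *)
From mathcomp Require Import all_boot all_order all_algebra.
From mathcomp Require Import all_classical.

Set Implicit Arguments.
Unset Strict Implicit.
Unset Printing Implicit Defensive.

Import GRing.Theory.
Local Open Scope classical_set_scope.
Local Open Scope card_scope.
Local Open Scope ring_scope.

(* MathComp's [free] and [basis_of] only exist for finite-dimensional spaces,
   hence the following three definitions for arbitrary ones. *)
Definition lin_indep (K : fieldType) (V : lmodType K) (B : set V) : Prop :=
  forall (s : seq V) (c : V -> K), uniq s -> [set` s] `<=` B ->
    \sum_(x <- s) c x *: x = 0 -> forall x, x \in s -> c x = 0.

Definition spanning (K : fieldType) (V : lmodType K) (B : set V) : Prop :=
  forall v : V, exists (s : seq V) (c : V -> K),
    [set` s] `<=` B /\ v = \sum_(x <- s) c x *: x.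

Definition is_basis (K : fieldType) (V : lmodType K) (B : set V) : Prop :=
  lin_indep B /\ spanning B.

Definition linear_covering (K : fieldType) (V : lmodType K)
    (I : Type) (W : I -> set V) : Prop :=
  (forall i, GRing.submod_closed [in W i] /\ W i `<` [set: V]) /\
  \bigcup_i W i = [set: V].

Definition irredundant (K : fieldType) (V : lmodType K)
    (I : Type) (W : I -> set V) : Prop :=
  forall J : set I, J `<` [set: I] -> \bigcup_(i in J) W i <> [set: V].

(* Cardinals are represented by types up to equipotence: [least_card P T] says
   that #T is the least cardinal #I of a type I satisfying P. *)
Definition least_card (P : Type -> Prop) (T : Type) : Prop :=
  (exists I : Type, P I /\ [set: I] #= [set: T]) /\
  (forall I : Type, P I -> [set: T] #<= [set: I]).

Definition LC_is (K : fieldType) (V : lmodType K) (T : Type) : Prop :=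
  least_card (fun I => exists W : I -> set V, linear_covering W) T.

Definition ILC_is (K : fieldType) (V : lmodType K) (T : Type) : Prop :=
  least_card
    (fun I => exists W : I -> set V, linear_covering W /\ irredundant W) T.

(* Every space has a basis, so that quantifying over the bases of V, whose
   common cardinal is dim V, is no restriction on V. *)
Lemma exists_basis (K : fieldType) (V : lmodType K) :
  exists B : set V, is_basis B.
Proof.
have [F Fli Ftot|B [Bli Bmax]] := @Zorn_bigcup V (@lin_indep K V).
  move=> s c us sF.
  have [->|[X FX sX]] : s = [::] \/ exists2 X, F X & [set` s] `<=` X.
  - elim: s {c us} sF => [|x s IHs] sF; [by left|right].
    have [Y FY Yx] : (\bigcup_(X in F) X) x by apply: sF; exact: mem_head.
    case: IHs => [y ys|->|[X FX sX]].
    + by apply: sF; rewrite /= inE; apply/orP; right.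
    + by exists Y => // y; rewrite /= inE => /eqP ->.
    + case: (Ftot _ _ FX FY) => XY; [exists Y|exists X] => // y;
        rewrite /= inE => /predU1P[->|ys] //; first exact/XY/sX.
      * exact: XY.
      * exact: sX.
  - by [].
  - exact: Fli FX s c us sX.
exists B; split => // v; apply: contrapT => vNB.
apply: (Bmax (v |` B)).
  split=> [x Bx|vBB]; first by right.
  apply: vNB; exists [:: v], (fun=> 1); split; last by rewrite big_seq1 scale1r.
  by move=> x; rewrite /= inE => /eqP ->; apply: vBB; left.
move=> s c us sB s0.
have [vs|vs] := boolP (v \in s); last first.
  apply: Bli s0 => // x xs; case: (sB x xs) => // xv.
  by move: vs; rewrite -xv xs.
have remB : [set` rem v s] `<=` B.
  move=> x; rewrite /= mem_rem_uniq // inE => /andP[xv xs].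
  by case: (sB x xs) => // /eqP; rewrite (negPf xv).
move: s0; rewrite (perm_big _ (perm_to_rem vs)) big_cons => s0.
have cv0 : c v = 0.
  apply: contrapT => /eqP cv; apply: vNB.
  exists (rem v s), (fun x => - ((c v)^-1 * c x)); split => //.
  apply: (scalerI cv); rewrite scaler_sumr; move/eqP: s0.
  rewrite addr_eq0 => /eqP ->; rewrite -sumrN; apply: eq_bigr => x _.
  by rewrite scalerA mulrN mulrA divff // mul1r scaleNr.
have {}s0 : \sum_(x <- rem v s) c x *: x = 0.
  by move: s0; rewrite cv0 scale0r; rewrite [LHS]add0r.
move=> x xs.
have [->//|xv] := eqVneq x v.
by apply: (Bli _ _ (rem_uniq v us) remB s0); rewrite mem_rem_uniq // inE xv.
Qed.

(* Main.v *)
(* #K + 1 is the number of lines in a plane: pulling these lines back along two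
   coordinates gives an irredundant covering.  Conversely a proper subspace meets
   a suitable projective line in at most one point, so that a map sending each
   point of the line to a subspace containing it is an injection of K + 1 into I.
   For irredundant coverings this is immediate; for coverings whose members all
   miss a vector of one fixed finite set, it follows by induction on the size of
   that set.  Such a set exists if dim V or I is finite.  When dim V is infinite,
   the subspaces of vectors with vanishing coordinates at e_n, e_(n+1), ... give a
   countable covering, and no finite one exists over an infinite field. *)
Require Import Defs.
From mathcomp Require Import all_boot all_order all_algebra.
From mathcomp Require Import all_classical.

Local Open Scope classical_set_scope.
Local Open Scope card_scope.

(** * Cardinal comparisons and injections *)

Section Cardinality.
Set Implicit Arguments.
Unset Strict Implicit.
Unset Printing Implicit Defensive.

Lemma injective_card_leT (T U : Type) (f : T -> U) :
  injective f -> [set: T] #<= [set: U].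
Proof.
move=> finj; have /injPex g : exists f : T -> U, set_inj [set: T] f.
  by exists f => x y _ _; apply: finj.
by case: g => g; apply: inj_card_le ('totalfun_setT g).
Qed.

(** The inhabitant [u0] is what allows a function defined on all of [T], even where [B] is empty. *)
Lemma card_le_injection (T U : Type) (u0 : U) (A : set T) (B : set U) :
  A #<= B -> exists2 f : T -> U, set_inj A f & set_fun A B f.
Proof.
elim/Ppointed: U => U in u0 B *; first by case: (no u0).
by move=> /pcard_leP[f]; exists f; [exact: inj | exact: funS].
Qed.

Lemma least_card_refl (P : Type -> Prop) (T : Type) :
  P T -> (forall I, P I -> [set: T] #<= [set: I]) -> least_card P T.
Proof. by move=> PT Tle; split=> //; exists T. Qed.

End Cardinality.

(** * Coordinates in a basis of arbitrary cardinality *)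

Section Coordinates.
Set Implicit Arguments.
Unset Strict Implicit.
Unset Printing Implicit Defensive.
Import GRing.Theory.
Local Open Scope ring_scope.
Variables (K : fieldType) (V : lmodType K) (B : set V).

(** Forcing [c] to vanish off the finite list makes it unique as a function on all of [V], whichever
    list witnesses its support. *)
Definition represents (v : V) (c : V -> K) : Prop :=
  exists s : seq V, [/\ uniq s, [set` s] `<=` B,
    forall x, x \notin s -> c x = 0 & v = \sum_(x <- s) c x *: x].

Lemma lincomb_widen (c : V -> K) (s t : seq V) :
    uniq s -> uniq t -> {subset s <= t} ->
    (forall x, x \notin s -> c x = 0) ->
  \sum_(x <- s) c x *: x = \sum_(x <- t) c x *: x.
Proof.
move=> us ut st c0; rewrite [RHS](bigID (mem s)) /= [X in _ + X]big1 ?addr0.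
  rewrite -[RHS]big_filter; apply: perm_big; apply: uniq_perm => //.
    exact: filter_uniq.
  by move=> x; rewrite mem_filter; case: (boolP (x \in s)) => // /st ->.
by move=> x xs; rewrite c0 // scale0r.
Qed.

Lemma represents_linear (a : K) (u v : V) (c d : V -> K) :
  represents u c -> represents v d ->
  represents (a *: u + v) (fun x => a * c x + d x).
Proof.
move=> [s [us sB c0 ->]] [t [ut tB d0 ->]].
exists (undup (s ++ t)); split.
- exact: undup_uniq.
- by move=> x; rewrite /= mem_undup mem_cat => /orP[/sB|/tB].
- move=> x; rewrite mem_undup mem_cat negb_or => /andP[/c0 -> /d0 ->].
  by rewrite mulr0 addr0.
have st_s : {subset s <= undup (s ++ t)}.
  by move=> x xs; rewrite mem_undup mem_cat xs.
have st_t : {subset t <= undup (s ++ t)}.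
  by move=> x xt; rewrite mem_undup mem_cat xt orbT.
rewrite (lincomb_widen us (undup_uniq _) st_s c0).
rewrite (lincomb_widen ut (undup_uniq _) st_t d0).
rewrite scaler_sumr -big_split; apply: eq_bigr => x _.
by rewrite scalerDl scalerA.
Qed.

Lemma represents_basis (b : V) : B b -> represents b (fun x => (x == b)%:R).
Proof.
move=> Bb; exists [:: b]; split=> //.
- by move=> x; rewrite /= inE => /eqP ->.
- by move=> x; rewrite inE => /negPf ->.
by rewrite big_seq1 eqxx scale1r.
Qed.

Hypothesis basisB : is_basis B.

Lemma represents_unique (v : V) (c d : V -> K) :
  represents v c -> represents v d -> c = d.
Proof.
move=> vc vd; apply/funext => x.
(* The difference [d - c] represents [0]: independence kills it on [s], and [e0] kills it
   elsewhere. *)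
have [s [us sB e0 s0]] := represents_linear (-1) vc vd.
rewrite scaleN1r addNr in s0; apply/eqP; rewrite eq_sym -subr_eq0; apply/eqP.
have [xs|/e0] := boolP (x \in s); last by rewrite mulN1r addrC.
by have := basisB.1 s _ us sB (esym s0) x xs; rewrite mulN1r addrC.
Qed.

Lemma represents_exists (v : V) : exists c, represents v c.
Proof.
have [s [c [sB ->]]] := basisB.2 v.
(* The spanning list may repeat vectors, so its coefficients cannot be reused as they stand; the
   terms are added one at a time. *)
elim: s sB => [|x s IHs] sB.
  by exists (fun=> 0); exists [::]; split=> //; rewrite !big_nil.
rewrite big_cons.
have [|d sd] := IHs; first by move=> y ys; apply: sB; rewrite /= inE ys orbT.
have Bx : B x by apply: sB; rewrite /= mem_head.
by eexists; apply: represents_linear (represents_basis Bx) sd.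
Qed.

Definition coord (v : V) : V -> K := sval (cid (represents_exists v)).

Lemma coordP (v : V) : represents v (coord v).
Proof. exact: svalP (cid (represents_exists v)). Qed.

Lemma coordE (v : V) (c : V -> K) : represents v c -> coord v = c.
Proof. exact/represents_unique/coordP. Qed.

Lemma coord_linear (a : K) (u v x : V) :
  coord (a *: u + v) x = a * coord u x + coord v x.
Proof.
by rewrite (coordE (represents_linear a (coordP u) (coordP v))).
Qed.

Lemma coord0 (x : V) : coord 0 x = 0.
Proof.
by have := coord_linear (-1) 0 0 x; rewrite scaler0 addr0 mulN1r addNr.
Qed.

Lemma coord_basis (b x : V) : B b -> coord b x = (x == b)%:R.
Proof. by move=> /represents_basis /coordE ->. Qed.

Lemma coord_support (v : V) :
  exists s : seq V, forall x, x \notin s -> coord v x = 0.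
Proof. by have [s []] := coordP v; exists s. Qed.

End Coordinates.

(** * Subspaces, projective lines and coverings *)

Section Coverings.
Set Implicit Arguments.
Unset Strict Implicit.
Unset Printing Implicit Defensive.
Import GRing.Theory.
Local Open Scope ring_scope.
Variables (K : fieldType) (V : lmodType K).

Lemma setproperT (W : set V) (v : V) : ~ W v -> W `<` [set: V].
Proof. by move=> nWv; split=> // /(_ v I). Qed.

Lemma submod_setP (W : set V) : GRing.submod_closed [in W] <->
  W 0 /\ forall a u v, W u -> W v -> W (a *: u + v).
Proof.
split=> [[W0 WD]|[W0 WD]]; split.
- by move: W0; rewrite inE.
- move=> a u v Wu Wv; have := WD a u v; rewrite !inE; exact.
- by rewrite inE.
- by move=> a u v; rewrite !inE; apply: WD.
Qed.

Lemma submod_setZ (W : set V) (a : K) (u : V) :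
  GRing.submod_closed [in W] -> W u -> W (a *: u).
Proof.
by move=> /submod_setP[W0 WD] Wu; rewrite -[_ *: _]addr0; apply: WD.
Qed.

Lemma submod_setD (W : set V) (u v : V) :
  GRing.submod_closed [in W] -> W u -> W v -> W (u + v).
Proof.
by move=> /submod_setP[_ WD] Wu Wv; rewrite -[u]scale1r; apply: WD.
Qed.

Lemma submod_set_sum (W : set V) (s : seq V) (c : V -> K) :
  GRing.submod_closed [in W] -> [set` s] `<=` W ->
  W (\sum_(x <- s) c x *: x).
Proof.
move=> Wsub; elim: s => [|x s IHs] sW.
  by rewrite big_nil; have /submod_setP[] := Wsub.
rewrite big_cons; apply: submod_setD => //.
  by apply: submod_setZ => //; apply: sW; rewrite /= mem_head.
by apply: IHs => y ys; apply: sW; rewrite /= inE ys orbT.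
Qed.

(** The difference of the two points is [(k - l) *: u]. *)
Lemma submod_line (W : set V) (u v : V) (k l : K) :
    GRing.submod_closed [in W] ->
  W (v + k *: u) -> W (v + l *: u) -> k != l -> W u.
Proof.
move=> Wsub Wk Wl kl.
have : W ((k - l)^-1 *: (-1 *: (v + l *: u) + (v + k *: u))).
  by apply: submod_setZ => //; have /submod_setP[_] := Wsub; apply.
rewrite scaleN1r opprD addrACA addNr add0r addrC -scalerBl scalerA.
by rewrite mulVf ?subr_eq0 // scale1r.
Qed.

(* The projective line through [x] and [y], with [None] for the point [y] at infinity. *)
Definition pencil (x y : V) (k : option K) : V :=
  if k is Some t then x + t *: y else y.

Lemma submod_pencil (W : set V) (x y : V) (k : option K) :
  GRing.submod_closed [in W] -> W x -> W y -> W (pencil x y k).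
Proof.
by case: k => //= t Wsub Wx Wy; apply: submod_setD => //; apply: submod_setZ.
Qed.

Lemma pencil_submod (W : set V) (x y : V) (k l : option K) :
    GRing.submod_closed [in W] -> k <> l ->
  W (pencil x y k) -> W (pencil x y l) -> W x /\ W y.
Proof.
move=> Wsub kl Wk Wl; suff Wy : W y.
  (* At most one of the two points is at infinity; a finite one yields [x] once [y] is known. *)
  split=> //; have [t Wt] : exists t, W (x + t *: y).
    by case: k l kl Wk Wl => [t|] [t'|] //= _ Wk Wl; [exists t|exists t|exists t'].
  rewrite -[x](addrK (t *: y)) -scaleNr.
  by apply: submod_setD => //; apply: submod_setZ.
case: k l kl Wk Wl => [t|] [t'|] //= kl Wk Wl.
by apply: submod_line Wk Wl _ => //; apply: contra_notN kl => /eqP ->.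
Qed.

(** Describing the span through the subspaces containing [s] lets generators be exchanged without
    handling coefficients. *)
Definition in_span (s : seq V) (v : V) : Prop :=
  forall U : set V, GRing.submod_closed [in U] -> [set` s] `<=` U -> U v.

(* Induction on the number of generators.  Replacing the first two generators
   x, y by a point of their pencil gives #K + 1 subspaces of smaller rank: either
   one of them lies in no [W i], hence is itself properly covered, or each lies in
   some [W i], and no [W i] contains two of them. *)
Lemma option_card_le_span_cover (I : Type) (W : I -> set V) (s : seq V) :
    (forall i, GRing.submod_closed [in W i]) ->
    (forall v, in_span s v -> exists i, W i v) ->
    (forall i, ~ [set` s] `<=` W i) ->
  [set: option K] #<= [set: I].
Proof.
move=> Wsub; have [n] := ubnP (size s); elim: n s => // n IHn.
case=> [|x [|y r]] sn cov prop.
(* With at most one generator, some member contains the whole list, against [prop]. *)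
- have [|i _] := cov 0; first by move=> U /submod_setP[].
  by case: (prop i).
- have [|i Wx] := cov x; first by move=> U _; apply; rewrite /= mem_head.
  by case: (prop i) => z; rewrite /= inE => /eqP ->.
have [[k prop_k]|allin] :=
    pselect (exists k, forall i, ~ [set` pencil x y k :: r] `<=` W i).
  apply: (IHn (pencil x y k :: r)) => // v vr; apply: cov => U Usub sU.
  apply: vr => // z; rewrite /= inE => /predU1P[->|zr].
    by apply: submod_pencil => //; apply: sU; rewrite /= !inE eqxx ?orbT.
  by apply: sU; rewrite /= !inE zr !orbT.
have /choice[f fP] k : exists i, [set` pencil x y k :: r] `<=` W i.
  apply: contrapT => nk; apply: allin; exists k => i kW.
  by apply: nk; exists i.
apply: (@injective_card_leT _ _ f) => k l fkl; apply: contrapT => kl.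
have Wk : W (f k) (pencil x y k) by apply: fP; rewrite /= mem_head.
have Wl : W (f k) (pencil x y l) by rewrite fkl; apply: fP; rewrite /= mem_head.
have [Wx Wy] := pencil_submod (Wsub _) kl Wk Wl.
apply: (prop (f k)) => z; rewrite /= !inE => /or3P[/eqP->|/eqP->|zr] //.
by apply: fP; rewrite /= inE zr orbT.
Qed.

Lemma linear_covering_ex (I : Type) (W : I -> set V) (v : V) :
  linear_covering W -> exists i, W i v.
Proof.
case=> _ WT; have [i _ Wv] : (\bigcup_i W i) v by rewrite WT.
by exists i.
Qed.

Lemma option_card_le_covering (I : Type) (W : I -> set V) (s : seq V) :
    linear_covering W -> (forall i, ~ [set` s] `<=` W i) ->
  [set: option K] #<= [set: I].
Proof.
move=> Wcov sW; apply: option_card_le_span_cover sW => [i|v _].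
  by case: Wcov => /(_ i)[].
exact: linear_covering_ex.
Qed.

Lemma option_card_le_finite_covering (I : Type) (W : I -> set V) :
    linear_covering W -> finite_set [set: I] ->
  [set: option K] #<= [set: I].
Proof.
move=> Wcov Ifin.
(* One missed vector per member: finitely many members yield a finite list. *)
have /choice[x xP] i : exists x, ~ W i x.
  by case: Wcov => /(_ i)[_ [_ /existsNP[x /not_implyP[_ Wx]]]] _; exists x.
have /finite_seqP[s sE] : finite_set (range x) by exact: finite_image.
apply: (option_card_le_covering (s := s) Wcov) => i sW.
by apply: (xP i); apply: sW; rewrite -sE; exists i.
Qed.

(** A proper subspace cannot contain a whole basis, so a finite basis is itself the list
    required. *)
Lemma option_card_le_covering_finite_basis (B : set V) (I : Type)
    (W : I -> set V) :
    is_basis B -> finite_set B -> linear_covering W ->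
  [set: option K] #<= [set: I].
Proof.
move=> basisB /finite_seqP[s sB] Wcov.
apply: (option_card_le_covering (s := s) Wcov) => i sW.
case: Wcov => /(_ i)[Wsub [_ WiT]] _; apply: WiT => v _.
have [t [c [tB ->]]] := basisB.2 v.
by apply: submod_set_sum => //; apply: subset_trans tB _; rewrite sB.
Qed.

(* For [u] in [W i0] alone and [v] outside [W i0], each subspace contains at most
   one point of the projective line through [v] and [u]. *)
Lemma option_card_le_irredundant (I : Type) (W : I -> set V) :
    linear_covering W -> irredundant W ->
  [set: option K] #<= [set: I].
Proof.
move=> Wcov Wirr; have [i0 _] := linear_covering_ex 0 Wcov.
have [v Wv] : exists v, ~ W i0 v.
  by case: Wcov => /(_ i0)[_ [_ /existsNP[v /not_implyP[_ Wv]]]] _; exists v.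
have [u uP] : exists u, ~ (\bigcup_(i in [set~ i0]) W i) u.
  apply/existsNP => allu; apply: (Wirr [set~ i0]); last first.
    by apply/seteqP; split=> // z _; apply: allu.
  by split=> // /(_ i0 Logic.I); apply.
have /choice[f fP] k := linear_covering_ex (pencil v u k) Wcov.
apply: (@injective_card_leT _ _ f) => k l fkl; apply: contrapT => kl.
have Wsub : GRing.submod_closed [in W (f k)] by case: Wcov => /(_ (f k))[].
have Wl : W (f k) (pencil v u l) by rewrite fkl.
have [Wfv Wfu] := pencil_submod Wsub kl (fP k) Wl.
by apply: uP; exists (f k) => // fk; apply: Wv; rewrite -fk.
Qed.

Variable B : set V.
Hypothesis basisB : is_basis B.
Local Notation coord := (coord basisB).

(** Both explicit coverings below are cut out by linear conditions on coordinates. *)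
Lemma submod_coord (P : (V -> K) -> Prop) :
    P (fun=> 0) ->
    (forall (a : K) c d, P c -> P d -> P (fun x => a * c x + d x)) ->
  GRing.submod_closed [in [set v | P (coord v)]].
Proof.
move=> P0 PD; apply/submod_setP; split=> [|a u v] /=.
  by rewrite (_ : coord 0 = fun=> 0) //; apply/funext => x; apply: coord0.
move=> Pu Pv; rewrite (_ : coord _ = fun x => a * coord u x + coord v x).
  exact: PD.
by apply/funext => x; apply: coord_linear.
Qed.

(* Pull back along the coordinates at [e1], [e2] of the #K + 1 lines of the plane. *)
Definition plane_cover (e1 e2 : V) (k : option K) : set V :=
  if k is Some t then [set v | coord v e1 = t * coord v e2]
  else [set v | coord v e2 = 0].

Lemma plane_coverP (e1 e2 : V) : B e1 -> B e2 -> e1 <> e2 ->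
  linear_covering (plane_cover e1 e2) /\ irredundant (plane_cover e1 e2).
Proof.
move=> B1 B2 /eqP e12.
(* The vector [w k] lies in the member of index [k] and in no other, which gives both irredundance
   and properness. *)
pose w (k : option K) := if k is Some t then t *: e1 + e2 else e1.
have c1 k : coord (w k) e1 = if k is Some t then t else 1.
  case: k => [t|] /=; rewrite ?coord_linear !coord_basis // eqxx //.
  by rewrite (negPf e12) mulr1 addr0.
have c2 k : coord (w k) e2 = if k is Some t then 1 else 0.
  case: k => [t|] /=; rewrite ?coord_linear !coord_basis // eq_sym (negPf e12) //.
  by rewrite eqxx mulr0 add0r.
have wP k l : plane_cover e1 e2 l (w k) <-> k = l.
  have := c2 k; have := c1 k; case: l => [l|] /=.
    move=> -> ->; case: k => [k|]; rewrite ?mulr1 ?mulr0.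
      by split=> [->|[]].
    by split=> [/eqP|//]; rewrite oner_eq0.
  by move=> _ ->; case: k => [k|]; split=> // /eqP; rewrite oner_eq0.
have cov v : exists k, plane_cover e1 e2 k v.
  have [v0|v0] := eqVneq (coord v e2) 0; first by exists None.
  by exists (Some (coord v e1 / coord v e2)) => /=; rewrite divfK.
split; last first.
  move=> J [_ JT] JE; apply: JT => k _.
  by have [l Jl /wP ->] : (\bigcup_(i in J) plane_cover e1 e2 i) (w k) by rewrite JE.
split; last by apply/seteqP; split=> // v _; have [k] := cov v; exists k.
move=> k; split.
  case: k => [t|].
    apply: (submod_coord (P := fun c => c e1 = t * c e2)); first by rewrite mulr0.
    by move=> a c d -> ->; rewrite mulrDr mulrCA.
  apply: (submod_coord (P := fun c => c e2 = 0)) => //.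
  by move=> a c d -> ->; rewrite mulr0 addr0.
pose l : option K := if k is Some _ then None else Some 0.
by apply: (setproperT (v := w l)) => /wP; rewrite {}/l; case: k.
Qed.

Definition tail_cover (e : nat -> V) (n : nat) : set V :=
  [set v | forall m, (n <= m)%N -> coord v (e m) = 0].

Lemma tail_coverP (e : nat -> V) : injective e -> (forall n, B (e n)) ->
  linear_covering (tail_cover e).
Proof.
move=> einj eB; split=> [n|].
  split.
    apply: (submod_coord (P := fun c => forall m, (n <= m)%N -> c (e m) = 0)) => //.
    by move=> a c d c0 d0 m nm; rewrite c0 // d0 // mulr0 addr0.
  apply: (setproperT (v := e n)) => /(_ n (leqnn n)).
  by rewrite coord_basis // eqxx => /eqP; rewrite oner_eq0.
apply/seteqP; split=> // v _; have [s sP] := coord_support basisB v.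
(* By injectivity the sequence [e] meets the finite support [s] only finitely often. *)
suff [n nP] : exists n, forall m, (n <= m)%N -> e m \notin s.
  by exists n => // m nm; apply/sP/nP.
elim: s {sP} => [|x s [n nP]]; first by exists 0%N.
have [[k ek]|nx] := pselect (exists k, e k = x).
  exists (maxn n k.+1) => m; rewrite geq_max => /andP[nm km].
  rewrite inE negb_or nP // andbT -ek; apply/eqP => /einj mk.
  by rewrite mk ltnn in km.
exists n => m nm; rewrite inE negb_or nP // andbT.
by apply/eqP => emx; apply: nx; exists m.
Qed.

End Coverings.

Theorem mainTheorem1 (K : fieldType) (V : lmodType K)
    (B : set V) (basisB : is_basis B) (dim_ge2 : `I_2 #<= B) :
  (~ (infinite_set B /\ infinite_set [set: K]) -> LC_is V (option K)) /\
  (infinite_set B /\ infinite_set [set: K] -> LC_is V nat) /\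
  ILC_is V (option K).
Proof.
have [e1 [e2 [B1 B2 e12]]] : exists e1 e2 : V, [/\ B e1, B e2 & e1 <> e2].
  have [f finj fB] := card_le_injection (GRing.zero : V) dim_ge2.
  exists (f 0%N), (f 1%N); split; [exact: fB|exact: fB|].
  by move/finj; rewrite !inE => /(_ isT isT).
have [pcov pirr] := plane_coverP basisB B1 B2 e12.
split; [|split].
- move=> fin; apply: least_card_refl; first by exists (plane_cover basisB e1 e2).
  move=> I [W Wcov].
  have [Ifin|Iinf] := pselect (finite_set [set: I]).
    exact: option_card_le_finite_covering Wcov Ifin.
  have [Bfin|Binf] := pselect (finite_set B).
    exact: option_card_le_covering_finite_basis basisB Bfin Wcov.
  (* With [I] and [B] infinite, [K] must be finite; then [option K] is countable and embeds in
     [I]. *)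
  have Kfin : finite_set [set: K].
    by apply: contrapT => Kinf; apply: fin.
  apply: card_le_trans (proj1 (infiniteP _) Iinf); apply: finite_set_countable.
  have -> : [set: option K] = None |` (Some @` [set: K]).
    by apply/seteqP; split=> // -[k|] _; [right; exists k|left].
  by rewrite finite_setU; split; [exact: finite_set1|exact: finite_image].
- move=> [Binf Kinf]; apply: least_card_refl.
    have [e einj eB] := card_le_injection (GRing.zero : V) (proj1 (infiniteP _) Binf).
    exists (tail_cover basisB e); apply: tail_coverP => [m n|n]; last exact: eB.
    by apply: einj; rewrite inE.
  (* A finite covering would bound [option K], hence [K], by a finite cardinal. *)
  move=> I [W Wcov]; apply/infiniteP => Ifin; apply: Kinf.
  apply: card_le_finite (Ifin).
  apply: card_le_trans (option_card_le_finite_covering Wcov Ifin).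
  by apply: (@injective_card_leT _ _ Some) => k l [].
- apply: least_card_refl; first by exists (plane_cover basisB e1 e2).
  by move=> I [W [Wcov Wirr]]; apply: option_card_le_irredundant Wcov Wirr.
Qed.
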